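(* Let $\mathbf G$ and $\mathbf K$ be finite abelian groups each having exactly two (nontrivial) Sylow subgroups, i.e. each of order divisible by exactly two primes. If $\mathcal D(\mathbf G)\cong\mathcal D(\mathbf K)$, then $\mathbf G\cong\mathbf K$.
   Context: The power graph of a group $\mathbf L$ is the simple graph on $L$ in which two distinct elements are adjacent iff one is a power of the other; the enhanced power graph of $\mathbf L$ is the simple graph on $L$ in which two distinct elements are adjacent iff they generate a cyclic subgroup. The difference graph $\mathcal D(\mathbf L)$ is the graph whose edges are the pairs adjacent in the enhanced power graph but not in the power graph, with all isolated vertices removed; $\cong$ between graphs denotes graph isomorphism. *)

(* Defs.v *)
From HB Require Import structures.
From mathcomp Require Import all_boot all_fingroup all_solvable.

Set Implicit Arguments.
Unset Strict Implicit.
Unset Printing Implicit Defensive.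

Local Open Scope group_scope.

Record sgraph (T : finType) := SGraph {
  adj :> rel T;
  adj_sym : symmetric adj;
  adj_irr : irreflexive adj
}.

Definition graph_iso (T U : finType) (g : sgraph T) (h : sgraph U) : Prop :=
  exists2 f : T -> U, bijective f & forall x y, h (f x) (f y) = g x y.

Section Operations.

Variable T : finType.
Implicit Types g h : sgraph T.

Definition edge_diff_rel g h : rel T := fun x y => g x y && ~~ h x y.

Fact edge_diff_sym g h : symmetric (edge_diff_rel g h).
Proof. by move=> x y; rewrite /edge_diff_rel !(adj_sym _ x y). Qed.

Fact edge_diff_irr g h : irreflexive (edge_diff_rel g h).
Proof. by move=> x; rewrite /edge_diff_rel adj_irr. Qed.

Definition edge_diff g h : sgraph T :=
  SGraph (edge_diff_sym g h) (edge_diff_irr g h).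

Definition non_isolated g : pred T := fun x => [exists y, g x y].

Definition delete_isolated_rel g : rel {x : T | non_isolated g x} :=
  fun x y => g (val x) (val y).

Fact delete_isolated_sym g : symmetric (@delete_isolated_rel g).
Proof. by move=> x y; apply: adj_sym. Qed.

Fact delete_isolated_irr g : irreflexive (@delete_isolated_rel g).
Proof. by move=> x; apply: adj_irr. Qed.

Definition delete_isolated g : sgraph {x : T | non_isolated g x} :=
  SGraph (@delete_isolated_sym g) (@delete_isolated_irr g).

End Operations.

Section PowerGraphs.

Variables (gT : finGroupType) (G : {group gT}).

(* In a finite group, membership in <[y]> is being a power of y (cycleP). *)
Definition power_rel : rel (subg_of G) := fun x y =>
  (x != y) && ((x \in <[y]>) || (y \in <[x]>)).

Fact power_sym : symmetric power_rel.
Proof. by move=> x y; rewrite /power_rel eq_sym orbC. Qed.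

Fact power_irr : irreflexive power_rel.
Proof. by move=> x; rewrite /power_rel eqxx. Qed.

Definition power_graph : sgraph (subg_of G) := SGraph power_sym power_irr.

Definition enhanced_power_rel : rel (subg_of G) := fun x y =>
  (x != y) && cyclic <<[set x; y]>>.

Fact enhanced_power_sym : symmetric enhanced_power_rel.
Proof. by move=> x y; rewrite /enhanced_power_rel eq_sym setUC. Qed.

Fact enhanced_power_irr : irreflexive enhanced_power_rel.
Proof. by move=> x; rewrite /enhanced_power_rel eqxx. Qed.

Definition enhanced_power_graph : sgraph (subg_of G) :=
  SGraph enhanced_power_sym enhanced_power_irr.

Definition difference_graph :=
  delete_isolated (edge_diff enhanced_power_graph power_graph).

End PowerGraphs.

(* Main.v *)
(** If [G] has exactly two Sylow subgroups [P] and [Q], its elements are the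
    pairs [(a, b)] of [P * Q].  Let [above a] and [below a] be the sets of all
    [c] such that [<[a]>] is a proper subgroup of [<[c]>], respectively such
    that [<[c]>] is a proper subgroup of [<[a]>].  In the difference graph the
    neighbours of [(a, b)] form the disjoint union of [above a * below b] and
    [below a * above b]; moreover [#|below a| = #[a] / p] and [p] divides
    [#|above a|] whenever [a != 1].

    By counting, a vertex [x] of maximal degree is of the form [(1, b)] or
    [(a, 1)]; say [x = (1, b)].  Its degree [(#|P| - 1) * #|below b|] is prime
    to [p].  The degree of any [(1, d)] with [d != 1], and the number of common
    neighbours of [(1, d)] and [x], divide the degree of [x]; but if [c != 1]
    then [p] divides one of these two numbers for [(c, d)].  So [x] determines
    the set of all [(1, d)] with [d != 1], and then the set of all [(a, 1)] with
    [a != 1], which are their common neighbours.  The cardinals of these sets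
    give [#|Q|] and [#|P|], after which the degree [(#|P| - 1) * #[d] / q] of
    [(1, d)] gives the order of [d], and likewise for the [(a, 1)].  Finally, a
    finite abelian group is determined by the numbers of its elements of each
    order. *)

Require Import Defs.
From HB Require Import structures.
From mathcomp Require Import all_boot all_fingroup all_solvable.

Set Implicit Arguments.
Unset Strict Implicit.
Unset Printing Implicit Defensive.

Local Open Scope group_scope.

(** * Graphs up to isolated vertices *)

Section DegreeInvariants.

Variables (T : finType) (g : sgraph T).
Implicit Types (x : T) (A B : {set T}).

Definition nbr x : {set T} := [set y | g x y].

Definition max_degree x : Prop := forall y, #|nbr y| <= #|nbr x|.

(* For a vertex [x = (1, b)] of maximal degree in the graph of pairs over
   [P * Q], the axis is the set of all [(1, d)] with [d != 1], and the coaxis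
   the set of all [(a, 1)] with [a != 1].  Then [(1, d)] has degree
   [#|coaxis x| * #[d] / q], where [q = pdiv #|Q|], so the axis count is the
   number of all [d != 1] whose order divides [n]. *)
Definition axis x : {set T} :=
  [set y | #|nbr y| %| #|nbr x| & #|nbr y :&: nbr x| %| #|nbr x|].

Definition coaxis x : {set T} := [set y | axis x \subset nbr y].

Definition divisor_count A B n : nat :=
  #|[set x in A | #|nbr x| * pdiv #|A|.+1 %| #|B| * n]|.

Definition axis_count x n : nat := divisor_count (axis x) (coaxis x) n.

Definition coaxis_count x n : nat := divisor_count (coaxis x) (axis x) n.

Lemma exists_max_degree x : exists y, max_degree y.
Proof.
case: (@arg_maxnP _ x predT (fun y => #|nbr y|)) => // y _ max_y.
by exists y => z; apply: max_y.
Qed.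

Lemma nbr_sym x y : (x \in nbr y) = (y \in nbr x).
Proof. by rewrite !inE adj_sym. Qed.

Lemma mem_axis x : x \in axis x.
Proof. by rewrite inE setIid dvdnn. Qed.

Lemma card_nbr_gt0 x : (0 < #|nbr x|) = non_isolated g x.
Proof.
by apply/card_gt0P/existsP=> -[y]; rewrite ?inE => gxy; exists y; rewrite ?inE.
Qed.

End DegreeInvariants.

Lemma non_isolated_delete_isolated (T : finType) (g : sgraph T) u :
  non_isolated (delete_isolated g) u.
Proof.
have /existsP[y xy] := valP u; have ny : non_isolated g y.
  by apply/existsP; exists (val u); rewrite adj_sym.
by apply/existsP; exists (Sub y ny); rewrite /= /delete_isolated_rel SubK.
Qed.

Definition core_embedding (T U : finType) (g : sgraph T) (h : sgraph U)
    (f : T -> U) : Prop :=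
  [/\ injective f, {mono f : x y / g x y >-> h x y}
    & forall y, non_isolated h y -> y \in codom f].

Lemma core_embedding_delete_isolated (T : finType) (g : sgraph T) :
  core_embedding (delete_isolated g) g val.
Proof.
split=> [||x nx] //; first exact: val_inj.
by apply/codomP; exists (Sub x nx).
Qed.

Lemma core_embedding_bij (T U : finType) (g : sgraph T) (h : sgraph U) f :
  bijective f -> {mono f : x y / g x y >-> h x y} -> core_embedding g h f.
Proof.
move=> f_bij fM; split=> [||y _] //; first exact: bij_inj.
by case: f_bij => f' _ f'K; rewrite -(f'K y) codom_f.
Qed.

Lemma core_embedding_comp (T U W : finType)
    (g : sgraph T) (h : sgraph U) (k : sgraph W) (f : T -> U) (e : U -> W) :
  core_embedding g h f -> core_embedding h k e -> core_embedding g k (e \o f).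
Proof.
case=> f_inj fM fC [e_inj eM eC]; split=> [|x y|z nz] /=.
- exact: inj_comp.
- by rewrite eM fM.
have /codomP[y def_z] := eC z nz; have /existsP[t zt] := nz.
have /eC/codomP[s def_t]: non_isolated k t.
  by apply/existsP; exists z; rewrite adj_sym.
rewrite def_z def_t eM in zt.
have /fC/codomP[x def_y]: non_isolated h y by apply/existsP; exists s.
by rewrite def_z def_y; apply: (codom_f (e \o f)).
Qed.

Section CoreEmbedding.

Variables (T U : finType) (g : sgraph T) (h : sgraph U) (f : T -> U).
Hypothesis fE : core_embedding g h f.
Implicit Types (x : T) (y : U) (A B : {set T}).

Let f_inj : injective f. Proof. by case: fE. Qed.

Lemma core_nbr x : nbr h (f x) = f @: nbr g x.
Proof.
case: fE => _ fM fC; apply/setP=> y; rewrite inE.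
apply/idP/imsetP=> [hxy | [z]]; last by rewrite inE => gxz ->; rewrite fM.
have /fC/codomP[z def_y]: non_isolated h y.
  by apply/existsP; exists (f x); rewrite adj_sym.
by exists z; rewrite // inE -fM -def_y.
Qed.

Lemma core_card_nbr x : #|nbr h (f x)| = #|nbr g x|.
Proof. by rewrite core_nbr card_imset. Qed.

Lemma core_codom y : 0 < #|nbr h y| -> exists x, y = f x.
Proof. by case: fE => _ _ fC; rewrite card_nbr_gt0 => /fC/codomP. Qed.

Lemma core_max_degree x : max_degree g x -> max_degree h (f x).
Proof.
move=> max_x y; case: (posnP #|nbr h y|) => [->|/core_codom[z ->]] //.
by rewrite !core_card_nbr.
Qed.

Lemma core_divisor_count A B n :
  divisor_count h (f @: A) (f @: B) n = divisor_count g A B n.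
Proof.
rewrite /divisor_count !card_imset // -[RHS](card_imset _ f_inj).
apply: eq_card => y; apply/setIdP/imsetP=> [[/imsetP[x Ax ->]] | [x]].
  by rewrite core_card_nbr => dvd_x; exists x; rewrite // inE Ax.
by rewrite inE => /andP[Ax dvd_x] ->; rewrite core_card_nbr imset_f.
Qed.

Section NonIsolated.

Variable x : T.
Hypothesis nx : non_isolated g x.

Lemma core_axis : axis h (f x) = f @: axis g x.
Proof.
have memE z : (f z \in axis h (f x)) = (z \in axis g x).
  rewrite !inE !core_card_nbr !core_nbr -imsetI ?card_imset //.
  by move=> z1 z2 _ _; apply: f_inj.
apply/setP=> y; apply/idP/imsetP=> [xy | [z + ->]]; last by rewrite memE.
have [|z def_y] := @core_codom y; last by exists z; rewrite // -memE -def_y.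
move: xy; rewrite inE core_card_nbr => /andP[/dvdn_gt0-> //].
by rewrite card_nbr_gt0.
Qed.

Lemma core_coaxis : coaxis h (f x) = f @: coaxis g x.
Proof.
have memE z : (f z \in coaxis h (f x)) = (z \in coaxis g x).
  rewrite !inE core_axis core_nbr sub_imset_pre; apply: eq_subset_r => t.
  by rewrite inE mem_imset.
apply/setP=> y; apply/idP/imsetP=> [xy | [z + ->]]; last by rewrite memE.
have [|z def_y] := @core_codom y; last by exists z; rewrite // -memE -def_y.
apply/card_gt0P; exists (f x); move: xy; rewrite inE => /subsetP; apply.
exact: mem_axis.
Qed.

Lemma core_axis_count n : axis_count h (f x) n = axis_count g x n.
Proof. by rewrite /axis_count core_coaxis core_axis core_divisor_count. Qed.

Lemma core_coaxis_count n : coaxis_count h (f x) n = coaxis_count g x n.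
Proof. by rewrite /coaxis_count core_coaxis core_axis core_divisor_count. Qed.

End NonIsolated.

End CoreEmbedding.

(** * Abelian groups from the numbers of solutions of [x ^+ n = 1] *)

Lemma isog_card_Ldiv (gT kT : finGroupType)
    (G : {group gT}) (K : {group kT}) n :
  G \isog K -> #|'Ldiv_n(G)| = #|'Ldiv_n(K)|.
Proof.
case/isogP=> f f_inj <-; rewrite -injm_Ldiv //.
by rewrite card_injm // (subset_trans (subsetIl _ _)).
Qed.

Lemma Ldiv1 (gT : finGroupType) (G : {group gT}) n : 1 \in 'Ldiv_n(G).
Proof. by rewrite !inE group1 expg1n eqxx. Qed.

Lemma card_Ldiv_dprod (gT : finGroupType) (G K H : {group gT}) n :
  K \x H = G -> #|'Ldiv_n(G)| = (#|'Ldiv_n(K)| * #|'Ldiv_n(H)|)%N.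
Proof.
move/mulgmP/misom_isog/isog_card_Ldiv <-; rewrite -cardsX.
apply: eq_card => x; rewrite !inE -(order_dvdn x.1) -(order_dvdn x.2) andbACA.
congr (_ && _); rewrite !order_dvdn -pair_eqE /pair_eq /=.
by rewrite (morphX [morphism of fst]) ?inE // (morphX [morphism of snd]) ?inE.
Qed.

Lemma exponent_card_Ldiv (gT kT : finGroupType)
    (G : {group gT}) (K : {group kT}) :
  (forall n, #|'Ldiv_n(G)| = #|'Ldiv_n(K)|) -> exponent G = exponent K.
Proof.
move=> eqL; have expE (hT : finGroupType) (H : {group hT}) n :
    (exponent H %| n) = (#|'Ldiv_n(H)| == #|'Ldiv_0(H)|).
  have ->: 'Ldiv_0(H) = H by apply/setIidPl/subsetP=> x; rewrite inE expg0.
  by rewrite -sub_Ldiv -(subset_leqif_card (subsetIl _ _)).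
have eq_dvd n : (exponent G %| n) = (exponent K %| n) by rewrite !expE !eqL.
by apply/eqP; rewrite eqn_dvd eq_dvd dvdnn -eq_dvd dvdnn.
Qed.

Lemma abelian_split_exponent (gT : finGroupType) (G : {group gT}) :
  abelian G ->
  exists (x : gT) (H : {group gT}), #[x] = exponent G /\ <[x]> \x H = G.
Proof.
move=> cGG; have [x Gx ox] := exponent_witness (abelian_nil cGG).
have /splitsP[H /complP[tixH defG]] := abelian_splits Gx (esym ox) cGG.
exists x, H; split; rewrite // dprodE //.
by rewrite (sub_abelian_cent2 cGG) ?cycle_subG // -defG mulG_subr.
Qed.

(* Split off a cyclic factor whose order is the exponent, which the numbers
   [#|'Ldiv_n(G)|] determine. *)
Lemma isog_abelian_card_Ldiv (gT kT : finGroupType)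
    (G : {group gT}) (K : {group kT}) :
    abelian G -> abelian K ->
    (forall n, #|'Ldiv_n(G)| = #|'Ldiv_n(K)|) ->
  G \isog K.
Proof.
have [m] := ubnP #|G|; elim: m => // m IHm in G K * => /ltnSE-leGm cGG cKK eqL.
have eq_exp := exponent_card_Ldiv eqL.
have [exp1 | ntG] := eqVneq (exponent G) 1%N.
  by apply: trivial_isog; apply/eqP; rewrite trivg_exponent -?eq_exp exp1.
have [x [H [ox defG]]] := abelian_split_exponent cGG.
have [y [L [oy defK]]] := abelian_split_exponent cKK.
have iso_xy: <[x]> \isog <[y]>.
  by rewrite isog_cyclic_card ?cycle_cyclic //= -!orderE ox oy eq_exp.
apply: (isog_dprod defG defK iso_xy); apply: IHm => [|||n].
- apply: leq_trans leGm; rewrite -(dprod_card defG) -orderE ltn_Pmull //.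
  by rewrite ox ltn_neqAle eq_sym ntG exponent_gt0.
- by apply: abelianS cGG; rewrite -(dprodW defG) mulG_subr.
- by apply: abelianS cKK; rewrite -(dprodW defK) mulG_subr.
have := eqL n; rewrite (card_Ldiv_dprod n defG) (card_Ldiv_dprod n defK).
rewrite -(isog_card_Ldiv n iso_xy) => /eqP.
by rewrite eqn_pmul2l => [/eqP // | ]; rewrite (cardD1 1) Ldiv1.
Qed.

(** * Cyclic subgroups of p-groups *)

Lemma p_elt_pdiv (gT : finGroupType) (p : nat) (a : gT) :
  p.-elt a -> a != 1 ->
  [/\ prime p, p %| #[a] & exists m, #[a] = (p ^ m.+1)%N].
Proof. by rewrite -cycle_eq1; apply: pgroup_pdiv. Qed.

Section CycleOrder.

Variable gT : finGroupType.
Implicit Types a b c : gT.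

Definition clt : rel gT := fun a b => <[a]> \proper <[b]>.
Definition above a : {set gT} := [set c | clt a c].
Definition below a : {set gT} := [set c | clt c a].

Lemma clt_irr : irreflexive clt.
Proof. by move=> a; apply: properxx. Qed.

Lemma clt_trans : transitive clt.
Proof. by move=> b a c; apply: proper_trans. Qed.

Lemma clt_asym a b : clt a b -> clt b a = false.
Proof. by move=> lt_ab; apply/negP=> /(clt_trans lt_ab); rewrite clt_irr. Qed.

Lemma clt1 a : clt 1 a = (a != 1).
Proof. by rewrite /clt cycle1 proper1G cycle_eq1. Qed.

Lemma cltn1 a : clt a 1 = false.
Proof. by rewrite /clt properE cycle1 sub1G andbF. Qed.

Lemma clt_neq1 a b : clt a b -> b != 1.
Proof. by apply: contraTneq => ->; rewrite cltn1. Qed.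

Lemma above1 : above 1 = [set~ 1].
Proof. by apply/setP=> c; rewrite !inE clt1. Qed.

Lemma below1 : below 1 = set0.
Proof. by apply/setP=> c; rewrite !inE cltn1. Qed.

Lemma card_below_gt0 a : (0 < #|below a|) = (a != 1).
Proof.
have [->|nt_a] := eqVneq; first by rewrite below1 cards0.
by apply/card_gt0P; exists 1; rewrite inE clt1.
Qed.

Lemma card_above_lt a : a != 1 -> #|above a| < #|above (1 : gT)|.
Proof.
move=> nt_a; apply/proper_card/properP; split.
  by apply/subsetP=> c; rewrite !inE clt1 => /clt_neq1.
by exists a; rewrite inE ?clt1 ?clt_irr.
Qed.

Lemma belowE (p : nat) a : p.-elt a -> a != 1 -> below a = <[a ^+ p]>.
Proof.
move=> p_a nt_a; have [p_pr _ [k oa]] := p_elt_pdiv p_a nt_a.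
have nonpgen n : ~~ generator <[a]> (a ^+ n) = (p %| n).
  by rewrite generator_coprime oa coprime_pexpl // prime_coprime ?negbK.
apply/setP=> c; rewrite inE /clt properEneq eq_sym -/(generator _ c) cycle_subG.
apply/andP/idP=> [[ngen /cycleP[n def_c]] | /cycleP[n ->]].
  move: ngen; rewrite def_c nonpgen => /dvdnP[m ->].
  by rewrite mulnC expgM mem_cycle.
by rewrite -expgM nonpgen dvdn_mulr ?mem_cycle.
Qed.

Lemma card_below (p : nat) a :
  p.-elt a -> a != 1 -> (#|below a| * p = #[a])%N.
Proof.
move=> p_a nt_a; have [_ p_dvd _] := p_elt_pdiv p_a nt_a.
by rewrite (belowE p_a nt_a) -orderE orderXdiv ?divnK.
Qed.

Lemma dvdn_card_below (p : nat) a c :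
    p.-elt a -> p.-elt c -> a != 1 -> #|below a| <= #|below c| ->
  #|below a| %| #|below c|.
Proof.
move=> p_a p_c nt_a le_ac; have [/prime_gt1 p_gt1 _ _] := p_elt_pdiv p_a nt_a.
have nt_c : c != 1.
  by rewrite -card_below_gt0 (leq_trans _ le_ac) // card_below_gt0.
have below_pnat z : p.-elt z -> z != 1 -> p.-nat #|below z|.
  move=> p_z nt_z; rewrite (belowE p_z nt_z).
  exact: mem_p_elt p_z (mem_cycle _ _).
have /p_natP[i a_i] := below_pnat a p_a nt_a.
have /p_natP[j c_j] := below_pnat c p_c nt_c.
by move: le_ac; rewrite a_i c_j leq_exp2l //; apply: dvdn_exp2l.
Qed.

Lemma card_below_clt (p : nat) a c :
  p.-elt a -> clt a c -> 2 * #|below a| <= #|below c|.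
Proof.
move=> p_a lt_ac; have [->|nt_a] := eqVneq a 1; first by rewrite below1 cards0.
have [/prime_gt1 p_gt1 _ _] := p_elt_pdiv p_a nt_a.
apply: (@leq_trans #[a]).
  by rewrite -(card_below p_a nt_a) mulnC leq_mul2l p_gt1 orbT.
apply/subset_leq_card/subsetP=> d; rewrite inE -cycle_subG => le_da.
exact: sub_proper_trans lt_ac.
Qed.

End CycleOrder.

Lemma dvdn_card_mulr_closed (gT : finGroupType)
    (H : {group gT}) (A : {set gT}) :
  {in A & H, forall x z, x * z \in A} -> #|H| %| #|A|.
Proof.
move=> AH; have actH: [acts H, on A | 'R].
  apply/actsP=> z Hz x /=; apply/idP/idP=> [/AH/(_ (groupVr Hz)) | /AH-> //].
  by rewrite mulgK.
rewrite (card_uniform_partition (n := #|H|) _ (orbit_partition actH)).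
  exact: dvdn_mull.
by move=> _ /imsetP[x _ ->]; rewrite orbitR card_lcoset.
Qed.

Lemma card_pred_gt0 (gT : finGroupType) :
  [set: gT] != 1 -> 0 < #|{: gT}|.-1.
Proof. by rewrite -cardsT -subn1 subn_gt0 cardG_gt1. Qed.

Section AbelianPgroup.

Variables (gT : finGroupType) (p : nat).
Hypotheses (pG : p.-group [set: gT]) (cGG : abelian [set: gT]).
Implicit Types a c : gT.

Lemma p_elt_pgroupT a : p.-elt a.
Proof. exact: mem_p_elt pG (in_setT a). Qed.

Lemma aboveE a : a != 1 -> above a = [set c | a \in <[c ^+ p]>].
Proof.
move=> nt_a; apply/setP=> c; rewrite !inE.
have [->|nt_c] := eqVneq c 1.
  by rewrite cltn1 expg1n cycle1 inE (negPf nt_a).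
by rewrite -(belowE (p_elt_pgroupT c) nt_c) inE.
Qed.

(* Translating [c] by an element of order [p] does not change [c ^+ p]. *)
Lemma dvdn_card_above a : a != 1 -> p %| #|above a|.
Proof.
move=> nt_a; have ntG: [set: gT] != 1 by apply/trivgPn; exists a.
have [p_pr p_dvd _] := pgroup_pdiv pG ntG; have [z _ oz] := Cauchy p_pr p_dvd.
rewrite -oz (aboveE nt_a); apply: dvdn_card_mulr_closed => c t.
rewrite !inE => ac /cycleP[n ->].
rewrite expgMn; last by apply: (centsP cGG); rewrite inE.
by rewrite -expgM mulnC expgM -oz expg_order expg1n mulg1 oz.
Qed.

End AbelianPgroup.

(** * The graph of pairs *)

Section PairGraph.

Variables pT qT : finGroupType.
Implicit Types x y : pT * qT.

Definition pair_rel : rel (pT * qT) := fun x y =>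
  clt x.1 y.1 && clt y.2 x.2 || clt y.1 x.1 && clt x.2 y.2.

Fact pair_sym : symmetric pair_rel.
Proof. by move=> x y; rewrite /pair_rel orbC. Qed.

Fact pair_irr : irreflexive pair_rel.
Proof. by move=> x; rewrite /pair_rel !clt_irr. Qed.

Definition pair_graph : sgraph (pT * qT)%type := SGraph pair_sym pair_irr.

Lemma nbr_pair x : nbr pair_graph x =
  setX (above x.1) (below x.2) :|: setX (below x.1) (above x.2).
Proof. by apply/setP=> y; rewrite !inE. Qed.

Lemma card_nbr_pair x : #|nbr pair_graph x| =
  (#|above x.1| * #|below x.2| + #|below x.1| * #|above x.2|)%N.
Proof.
rewrite nbr_pair -!cardsX cardsU (_ : _ :&: _ = set0) ?cards0 ?subn0 //.
apply/setP=> y; rewrite !inE; apply/negP=> /andP[/andP[lt_xy _] /andP[]].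
by rewrite (clt_asym lt_xy).
Qed.

Lemma nbr_pair1 b : nbr pair_graph (1, b) = setX [set~ 1] (below b).
Proof. by apply/setP=> y; rewrite nbr_pair above1 below1 !inE /= orbF. Qed.

Lemma nbr_pair1I b d :
  nbr pair_graph (1, b) :&: nbr pair_graph (1, d)
    = setX [set~ 1] (below b :&: below d).
Proof. by apply/setP=> y; rewrite !nbr_pair1 !inE andbACA andbb. Qed.

Lemma card_nbr_pair1 b :
  #|nbr pair_graph (1, b)| = (#|{: pT}|.-1 * #|below b|)%N.
Proof. by rewrite nbr_pair1 cardsX cardsC1. Qed.

Lemma card_nbr_pairn1 a :
  #|nbr pair_graph (a, 1)| = (#|{: qT}|.-1 * #|below a|)%N.
Proof. by rewrite card_nbr_pair below1 cards0 muln0 above1 cardsC1 mulnC. Qed.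

Lemma ltn_card_above_below (k : nat) (a : pT) (b d : qT) :
    a != 1 -> d != 1 -> k * #|below b| <= #|below d| ->
  k * (#|above a| * #|below b|) < #|{: pT}|.-1 * #|below d|.
Proof.
move=> nt_a nt_d le_k; rewrite mulnCA -(cardsC1 (1 : pT)) -above1.
apply: (@leq_ltn_trans (#|above a| * #|below d|)).
  by rewrite leq_mul2l le_k orbT.
by rewrite ltn_pmul2r ?card_below_gt0 // card_above_lt.
Qed.

End PairGraph.

(* If [d] is above [b] and [c] above [a], then the degree of [(1, d)] is more
   than twice [#|above a| * #|below b|], and that of [(c, 1)] is more than twice
   [#|below a| * #|above b|]. *)
Lemma max_degree_pair_eq1 (pT qT : finGroupType) (p q : nat) (x : pT * qT) :
    p.-group [set: pT] -> q.-group [set: qT] ->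
  max_degree (pair_graph pT qT) x -> (x.1 == 1) || (x.2 == 1).
Proof.
case: x => a b pP qQ max_ab; apply: contraT => /norP[/= nt_a nt_b].
set D := #|nbr (pair_graph pT qT) (a, b)|.
have ltQ k (d : qT) : d != 1 -> k * #|below b| <= #|below d| ->
    k * (#|above a| * #|below b|) < D.
  move=> nt_d le_k; apply: leq_trans _ (max_ab (1, d)); rewrite card_nbr_pair1.
  exact: ltn_card_above_below.
have ltP k (c : pT) : c != 1 -> k * #|below a| <= #|below c| ->
    k * (#|above b| * #|below a|) < D.
  move=> nt_c le_k; apply: leq_trans _ (max_ab (c, 1)); rewrite card_nbr_pairn1.
  exact: ltn_card_above_below.
have defD : D = (#|above a| * #|below b| + #|above b| * #|below a|)%N.
  by rewrite /D card_nbr_pair [X in (_ + X)%N]mulnC.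
have [b0 | [d]] := set_0Vmem (above b).
  by have := ltQ 1%N b nt_b; rewrite !mul1n defD b0 cards0 addn0 ltnn => ->.
have [a0 | [c]] := set_0Vmem (above a).
  by have := ltP 1%N a nt_a; rewrite !mul1n defD a0 cards0 ltnn => ->.
rewrite !inE => lt_ac lt_bd.
have le2_bd := card_below_clt (p_elt_pgroupT qQ b) lt_bd.
have le2_ac := card_below_clt (p_elt_pgroupT pP a) lt_ac.
have [nt_c nt_d] := (clt_neq1 lt_ac, clt_neq1 lt_bd).
have := leq_add (ltQ 2 d nt_d le2_bd) (ltP 2 c nt_c le2_ac).
by rewrite addSn addnS -mulnDr -defD mul2n addnn ltnNge leqnSn.
Qed.

Section AxisOfPgroups.

Variables (pT qT : finGroupType) (p q : nat).
Hypotheses (pP : p.-group [set: pT]) (qQ : q.-group [set: qT]).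
Hypotheses (ntP : [set: pT] != 1) (ntQ : [set: qT] != 1).
Let g := pair_graph pT qT.
Implicit Types (c : pT) (b d : qT).

Definition fst_axis : {set pT * qT} := setX [set~ 1] [set 1].
Definition snd_axis : {set pT * qT} := setX [set 1] [set~ 1].

Lemma card_fst_axis : #|fst_axis| = #|{: pT}|.-1.
Proof. by rewrite cardsX cards1 muln1 cardsC1. Qed.

Lemma cardS_snd_axis : #|snd_axis|.+1 = #|{: qT}|.
Proof. by rewrite cardsX cards1 mul1n cardsC1 prednK // -cardsT. Qed.

Lemma common_nbr_snd_axis : [set x | snd_axis \subset nbr g x] = fst_axis.
Proof.
apply/setP=> -[c d]; rewrite !inE /=.
apply/subsetP/andP=> [adj | [nt_c /eqP->] [e b] /setXP[/set1P-> +]]; last first.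
  by rewrite in_setC1 => nt_b; rewrite nbr_sym nbr_pair1 !inE nt_c clt1.
have adj1 b : b != 1 -> (c != 1) && clt d b.
  move=> nt_b; have /adj: (1, b) \in snd_axis by rewrite !inE eqxx.
  by rewrite nbr_sym nbr_pair1 !inE.
have [b _ nt_b] := trivgPn _ ntQ; have /andP[nt_c _] := adj1 b nt_b.
split=> //; apply: contraT => /adj1.
by rewrite clt_irr andbF.
Qed.

(* If the first number is not divisible by [p] then [c] has order [p], so that
   no common neighbour of [(c, d)] and [(1, b)] lies in [below c * above d]. *)
Lemma dvdn_degree_codegree b c d : abelian [set: pT] -> c != 1 ->
  (p %| #|nbr g (c, d)|) || (p %| #|nbr g (c, d) :&: nbr g (1, b)|).
Proof.
move=> cPP nt_c; have p_above := dvdn_card_above pP cPP nt_c.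
rewrite -implyNb; apply/implyP; rewrite card_nbr_pair dvdn_addr /=; last first.
  exact: dvdn_mulr.
move=> p'below; have below_c : below c = [set 1].
  have p_elt := p_elt_pgroupT pP; apply: contraNeq p'below.
  rewrite (belowE (p_elt c) nt_c) cycle_eq1.
  case/(p_elt_pdiv (p_elt _)) => _ p_dvd _.
  exact: dvdn_mulr.
rewrite (_ : _ :&: _ = setX (above c) (below d :&: below b)).
  by rewrite cardsX dvdn_mulr.
apply/setP=> -[a e]; rewrite nbr_pair nbr_pair1 below_c !inE /=.
have [-> | _] := eqVneq a 1; first by rewrite cltn1 andbF.
by rewrite /= orbF andbA.
Qed.

Section MaxDegree.

Variable b : qT.
Hypothesis max_b : max_degree g (1, b).

Lemma max_degree_leq_below d : #|below d| <= #|below b|.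
Proof.
by have := max_b (1, d); rewrite !card_nbr_pair1 leq_pmul2l ?card_pred_gt0.
Qed.

Lemma max_degree_neq1 : b != 1.
Proof.
have [d _ nt_d] := trivgPn _ ntQ; rewrite -card_below_gt0.
by apply: leq_trans (max_degree_leq_below d); rewrite card_below_gt0.
Qed.

Hypothesis neq_pq : p != q.

Lemma ndvdn_max_degree : ~~ (p %| #|nbr g (1, b)|).
Proof.
have [p_pr p_dvd _] := pgroup_pdiv pP ntP; have q_b := p_elt_pgroupT qQ b.
rewrite card_nbr_pair1 Euclid_dvdM // negb_or; apply/andP; split; last first.
  rewrite (belowE q_b max_degree_neq1); apply: contra neq_pq.
  exact: (pgroupP (mem_p_elt q_b (mem_cycle b q)) p p_pr).
rewrite -cardsT; apply/negP=> /(dvdn_sub p_dvd).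
by rewrite -subn1 subKn ?cardG_gt0 // dvdn1 => /eqP p1; rewrite p1 in p_pr.
Qed.

Lemma axis_max_degree : abelian [set: pT] -> axis g (1, b) = snd_axis.
Proof.
move=> cPP; have p'_dvd n : n %| #|nbr g (1, b)| -> ~~ (p %| n).
  by move=> n_dvd; apply: contra ndvdn_max_degree => /dvdn_trans->.
apply/setP=> -[c d]; rewrite !inE /=.
have [-> | nt_c] := eqVneq c 1; last first.
  apply/negP=> /andP[/p'_dvd/negPf p'deg /p'_dvd/negPf p'codeg].
  by have := dvdn_degree_codegree b d cPP nt_c; rewrite p'deg p'codeg.
have [-> | nt_d] := eqVneq d 1.
  apply/negP=> /andP[/p'_dvd].
  by rewrite card_nbr_pair1 below1 cards0 muln0 dvdn0.
rewrite nbr_pair1I !card_nbr_pair1 cardsX cardsC1.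
have q_elt := p_elt_pgroupT qQ; rewrite !dvdn_mul //.
  by rewrite !(belowE (q_elt _)) ?max_degree_neq1 // cardSg ?subsetIr.
exact: dvdn_card_below (max_degree_leq_below d).
Qed.

Lemma coaxis_max_degree : abelian [set: pT] -> coaxis g (1, b) = fst_axis.
Proof.
by move=> cPP; rewrite /coaxis axis_max_degree // common_nbr_snd_axis.
Qed.

End MaxDegree.

Lemma dvdn_card_below_pdiv (hT : finGroupType) (r k n : nat) (d : hT) :
    r.-group [set: hT] -> 0 < k -> d != 1 ->
  (k * #|below d| * pdiv #|hT| %| k * n) = (d ^+ n == 1).
Proof.
move=> rH k_gt0 nt_d; have ntH : [set: hT] != 1 by apply/trivgPn; exists d.
have [r_pr _ [m]] := pgroup_pdiv rH ntH; rewrite cardsT => ->.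
rewrite pdiv_pfactor // -mulnA dvdn_pmul2l //.
by rewrite (card_below (p_elt_pgroupT rH d) nt_d) order_dvdn.
Qed.

Lemma card_Ldiv_snd_axis n :
  #|'Ldiv_n([set: qT])| = (divisor_count g snd_axis fst_axis n).+1.
Proof.
rewrite (cardsD1 1) Ldiv1 add1n.
rewrite -[in LHS](mul1n #|_|) -(cards1 (1 : pT)) -cardsX.
congr _.+1; apply: eq_card => -[c d]; rewrite !inE /=.
have [-> | //] := eqVneq c 1; have [// | nt_d] := eqVneq d 1.
rewrite cardS_snd_axis card_fst_axis card_nbr_pair1.
by rewrite (dvdn_card_below_pdiv _ qQ) ?card_pred_gt0.
Qed.

End AxisOfPgroups.

Lemma divisor_count_swap (pT qT : finGroupType) n :
  divisor_count (pair_graph pT qT) (fst_axis pT qT) (snd_axis pT qT) n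
    = divisor_count (pair_graph qT pT) (snd_axis qT pT) (fst_axis qT pT) n.
Proof.
pose swap (hT kT : finGroupType) (x : hT * kT) := (x.2, x.1).
have swapK hT kT : cancel (@swap hT kT) (@swap kT hT) by case.
have swapE : core_embedding (pair_graph pT qT) (pair_graph qT pT) (@swap _ _).
  apply: core_embedding_bij => [|x y]; first by exists (@swap _ _).
  by rewrite /= /pair_rel /= orbC; congr (_ || _); rewrite andbC.
rewrite -(core_divisor_count swapE).
rewrite !(can2_imset_pre _ (@swapK _ _) (@swapK _ _)).
by congr divisor_count; apply/setP=> x; rewrite !inE andbC.
Qed.

Section CoreEmbeddingPairGraph.

Variables (pT qT : finGroupType) (p q : nat).
Hypotheses (pP : p.-group [set: pT]) (qQ : q.-group [set: qT]).
Hypotheses (ntP : [set: pT] != 1) (ntQ : [set: qT] != 1).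
Hypotheses (cPP : abelian [set: pT]) (neq_pq : p != q).
Variables (T : finType) (g : sgraph T) (f : T -> pT * qT).
Hypothesis fE : core_embedding g (pair_graph pT qT) f.

Lemma exists_max_degree_pair : exists u, max_degree g u.
Proof.
have [b _ nt_b] := trivgPn _ ntQ.
have [|u _] := core_codom fE (y := (1, b)); last exact: exists_max_degree u.
by rewrite card_nbr_pair1 muln_gt0 card_pred_gt0 ?card_below_gt0.
Qed.

Variables (u : T) (b : qT).
Hypotheses (max_u : max_degree g u) (fu : f u = (1, b)).

Let max_b : max_degree (pair_graph pT qT) (1, b).
Proof. by rewrite -fu; apply: core_max_degree fE _ _. Qed.

Let non_isolated_u : non_isolated g u.
Proof.
rewrite -card_nbr_gt0 -(core_card_nbr fE) fu card_nbr_pair1 muln_gt0.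
by rewrite card_pred_gt0 ?card_below_gt0 ?(max_degree_neq1 ntP ntQ max_b).
Qed.

Lemma card_Ldiv_axis_count n :
  #|'Ldiv_n([set: qT])| = (axis_count g u n).+1.
Proof.
rewrite (card_Ldiv_snd_axis qQ ntP) -(core_axis_count fE non_isolated_u) fu.
by rewrite /axis_count (coaxis_max_degree pP qQ) // (axis_max_degree pP qQ).
Qed.

Lemma card_Ldiv_coaxis_count n :
  #|'Ldiv_n([set: pT])| = (coaxis_count g u n).+1.
Proof.
rewrite (card_Ldiv_snd_axis pP ntQ) -(core_coaxis_count fE non_isolated_u) fu.
rewrite -divisor_count_swap.
by rewrite /coaxis_count (coaxis_max_degree pP qQ) // (axis_max_degree pP qQ).
Qed.

End CoreEmbeddingPairGraph.

(** * The difference graph as a graph of pairs *)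

Lemma p_elt_neq (gT : finGroupType) (p q : nat) (x : gT) :
  p != q -> q.-elt x -> p^'.-elt x.
Proof.
by move=> neq_pq; apply: sub_in_pnat => r _ /eqnP->; rewrite !inE eq_sym.
Qed.

Lemma consttMl (gT : finGroupType) (pi : nat_pred) (x y : gT) :
  commute x y -> pi.-elt x -> pi^'.-elt y -> (x * y).`_pi = x.
Proof.
move=> cxy pi_x /constt1P pi'_y.
by rewrite consttM // constt_p_elt // pi'_y mulg1.
Qed.

Lemma p_elt_cycle_total (gT : finGroupType) (p : nat)
    (G : {group gT}) (a c : gT) :
    cyclic G -> a \in G -> c \in G -> p.-elt a -> p.-elt c ->
  (<[a]> \subset <[c]>) || (<[c]> \subset <[a]>).
Proof.
move=> cycG Ga Gc /p_natP[m oa] /p_natP[n oc].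
have subE b d : b \in G -> d \in G -> (<[b]> \subset <[d]>) = (#[b] %| #[d]).
  by move=> Gb Gd; rewrite -(cardSg_cyclic cycG) ?cycle_subG.
rewrite !subE // oa oc.
by case: (leqP m n) => [|/ltnW] /dvdn_exp2l->; rewrite ?orbT.
Qed.

Section Subgroup.

Variables (gT : finGroupType) (G : {group gT}).
Implicit Types x y : subg_of G.

Lemma cycle_sgval x : <[sgval x]> = sgval @* <[x]>.
Proof. by rewrite morphim_cycle ?inE. Qed.

Lemma mem_cycle_sgval x y : (sgval x \in <[sgval y]>) = (x \in <[y]>).
Proof.
by rewrite -!cycle_subG /= !cycle_sgval injmSK ?injm_sgval ?subsetT.
Qed.

Lemma clt_sgval x y : clt (sgval x) (sgval y) = clt x y.
Proof. by rewrite /clt !properE !cycle_subG !mem_cycle_sgval. Qed.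

Lemma cyclic_gen2_sgval x y :
  cyclic <<[set sgval x; sgval y]>> = cyclic <<[set x; y]>>.
Proof.
have -> : [set sgval x; sgval y] = sgval @* [set x; y].
  by rewrite morphimEsub ?subsetT // imsetU1 imset_set1.
by rewrite -morphim_gen ?subsetT // injm_cyclic ?injm_sgval ?subsetT.
Qed.

Lemma pgroup_subgT pi : pi.-group [set: subg_of G] = pi.-group G.
Proof. by rewrite /pgroup -(card_isog (isog_subg G)). Qed.

Lemma subgT_eq1 : ([set: subg_of G] == 1) = (G :==: 1).
Proof. by rewrite -(isog_eq1 (isog_subg G)). Qed.

End Subgroup.

Section DprodOfPgroups.

Variables (gT : finGroupType) (G P Q : {group gT}) (p q : nat).
Hypotheses (pP : p.-group P) (qQ : q.-group Q) (neq_pq : p != q).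
Hypothesis defG : P \x Q = G.
Implicit Types x y a b : gT.

Let neq_qp : q != p. Proof. by rewrite eq_sym. Qed.

Lemma commute_dprod a b : a \in P -> b \in Q -> commute a b.
Proof.
by case/dprodP: defG => _ _ /centsP cQP _ Pa Qb; apply/commute_sym/cQP.
Qed.

Lemma constt_dprod a b : a \in P -> b \in Q ->
  (a * b).`_p = a /\ (a * b).`_q = b.
Proof.
move=> Pa Qb; have cab := commute_dprod Pa Qb.
have [p_a q_b] := (mem_p_elt pP Pa, mem_p_elt qQ Qb).
split; first by rewrite consttMl // (p_elt_neq neq_pq).
by rewrite cab consttMl // (p_elt_neq neq_qp).
Qed.

Lemma dprod_constt x : x \in G ->
  [/\ x.`_p \in P, x.`_q \in Q & x.`_p * x.`_q = x].
Proof.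
rewrite -(dprodW defG) => /mulsgP[a b Pa Qb ->].
by have [-> ->] := constt_dprod Pa Qb.
Qed.

Lemma cycle_subset_dprod x y : x \in G ->
  (<[x]> \subset <[y]>) =
    (<[x.`_p]> \subset <[y.`_p]>) && (<[x.`_q]> \subset <[y.`_q]>).
Proof.
move=> Gx; rewrite !cycle_subG; apply/idP/andP=> [/cycleP[n ->] | [xp xq]].
  by rewrite !consttX !mem_cycle.
have [_ _ <-] := dprod_constt Gx.
by apply: groupM; [apply: subsetP xp | apply: subsetP xq];
  rewrite cycle_subG mem_cycle.
Qed.

Lemma cyclic_dprod_gen2 x y : x \in G -> y \in G ->
  cyclic <<[set x; y]>> =
    ((<[x.`_p]> \subset <[y.`_p]>) || (<[y.`_p]> \subset <[x.`_p]>)) &&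
    ((<[x.`_q]> \subset <[y.`_q]>) || (<[y.`_q]> \subset <[x.`_q]>)).
Proof.
move=> Gx Gy; apply/idP/andP=> [cyc | [cmp_p cmp_q]].
  have cmp (r : nat) : (<[x.`_r]> \subset <[y.`_r]>)
                    || (<[y.`_r]> \subset <[x.`_r]>).
    apply: p_elt_cycle_total cyc _ _ (p_elt_constt r x) (p_elt_constt r y).
      by rewrite groupX ?mem_gen ?inE ?eqxx.
    by rewrite groupX ?mem_gen ?inE ?eqxx ?orbT.
  by split.
have top (H : {group gT}) a b : a \in H -> b \in H ->
    (<[a]> \subset <[b]>) || (<[b]> \subset <[a]>) ->
    exists2 c, c \in H & a \in <[c]> /\ b \in <[c]>.
  move=> Ha Hb; rewrite !cycle_subG.
  by case/orP; [exists b | exists a]; rewrite ?cycle_id.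
have [xP xQ def_x] := dprod_constt Gx; have [yP yQ def_y] := dprod_constt Gy.
have [a Pa [xa ya]] := top P _ _ xP yP cmp_p.
have [b Qb [xb yb]] := top Q _ _ xQ yQ cmp_q.
have co_ab : coprime #[a] #[b].
  exact: pnat_coprime (mem_p_elt pP Pa) (p_elt_neq neq_pq (mem_p_elt qQ Qb)).
apply: cyclicS (cycle_cyclic (a * b)).
rewrite gen_subG /= (cycleM (commute_dprod Pa Qb) co_ab).
by apply/subsetP=> z /set2P[]->; rewrite -(def_x, def_y) mem_mulg.
Qed.

Definition dprod_pair (x : subg_of G) : subg_of P * subg_of Q :=
  (subg P (sgval x).`_p, subg Q (sgval x).`_q).

Lemma dprod_pair_bij : bijective dprod_pair.
Proof.
exists (fun u => subg G (sgval u.1 * sgval u.2)) => [x | [a b]].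
  have [xP xQ def_x] := dprod_constt (subgP x).
  by rewrite /= !subgK // def_x sgvalK.
have Gab : sgval a * sgval b \in G.
  by rewrite -(dprodW defG) mem_mulg ?subgP.
have [ab_p ab_q] := constt_dprod (subgP a) (subgP b).
by rewrite /dprod_pair subgK // ab_p ab_q !sgvalK.
Qed.

Lemma dprod_pair_mono :
  {mono dprod_pair : x y
    / edge_diff (enhanced_power_graph G) (power_graph G) x y
    >-> pair_graph (subg_of P) (subg_of Q) x y}.
Proof.
move=> x y; have [Gx Gy] := (subgP x, subgP y).
have [xP xQ _] := dprod_constt Gx; have [yP yQ _] := dprod_constt Gy.
rewrite /= /pair_rel -!clt_sgval /= !subgK //.
rewrite /edge_diff_rel /= /enhanced_power_rel /power_rel.
rewrite -!mem_cycle_sgval -cyclic_gen2_sgval cyclic_dprod_gen2 // -!cycle_subG.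
rewrite (cycle_subset_dprod _ Gx) (cycle_subset_dprod _ Gy).
have [-> | _] := eqVneq x y; first by rewrite !clt_irr.
by rewrite /clt !properE; do !case: (_ \subset _).
Qed.

Lemma core_embedding_difference_graph :
  core_embedding (difference_graph G) (pair_graph (subg_of P) (subg_of Q))
    (dprod_pair \o val).
Proof.
apply: core_embedding_comp (core_embedding_delete_isolated _) _.
exact: core_embedding_bij dprod_pair_bij dprod_pair_mono.
Qed.

Hypotheses (cGG : abelian G) (ntP : P :!=: 1) (ntQ : Q :!=: 1).

Let pPT : p.-group [set: subg_of P].
Proof. by rewrite pgroup_subgT. Qed.

Let qQT : q.-group [set: subg_of Q].
Proof. by rewrite pgroup_subgT. Qed.

Let ntPT : [set: subg_of P] != 1.
Proof. by rewrite subgT_eq1. Qed.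

Let ntQT : [set: subg_of Q] != 1.
Proof. by rewrite subgT_eq1. Qed.

Lemma exists_max_degree_dprod :
  exists u, max_degree (difference_graph G) u.
Proof. exact: exists_max_degree_pair core_embedding_difference_graph. Qed.

Lemma max_degree_dprod_pair u : max_degree (difference_graph G) u ->
  ((dprod_pair (val u)).1 == 1) || ((dprod_pair (val u)).2 == 1).
Proof.
move/(core_max_degree core_embedding_difference_graph).
exact: max_degree_pair_eq1 pPT qQT.
Qed.

Lemma card_Ldiv_difference_graph u n :
    max_degree (difference_graph G) u -> (dprod_pair (val u)).1 = 1 ->
  #|'Ldiv_n(P)| = (coaxis_count (difference_graph G) u n).+1 /\
  #|'Ldiv_n(Q)| = (axis_count (difference_graph G) u n).+1.
Proof.
move=> max_u u1; have cPP : abelian [set: subg_of P].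
  rewrite -(isog_abelian (isog_subg P)); apply: abelianS cGG.
  by rewrite -(dprodW defG) mulG_subl.
have fE := core_embedding_difference_graph.
have fu : (dprod_pair \o val) u = (1, (dprod_pair (val u)).2) by rewrite -u1.
rewrite (isog_card_Ldiv n (isog_subg P)) (isog_card_Ldiv n (isog_subg Q)).
split; first exact: (card_Ldiv_coaxis_count pPT qQT _ _ _ _ fE max_u fu).
exact: (card_Ldiv_axis_count pPT qQT _ _ _ _ fE max_u fu).
Qed.

End DprodOfPgroups.

Lemma pcore_neq1 (gT : finGroupType) (pi : nat_pred) (r : nat)
    (G : {group gT}) :
  abelian G -> r \in primes #|G| -> r \in pi -> 'O_pi(G) != 1.
Proof.
move=> cGG; rewrite mem_primes => /and3P[r_pr _ r_dvd] pi_r.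
have [x Gx ox] := Cauchy r_pr r_dvd.
apply/trivgPn; exists x; last by rewrite -order_gt1 ox prime_gt1.
have hallO := nilpotent_pcore_Hall pi (abelian_nil cGG).
by rewrite (mem_normal_Hall hallO) ?pcore_normal // /p_elt ox pnatE.
Qed.

Lemma two_primes_dprod (gT : finGroupType) (G : {group gT}) :
    abelian G -> size (primes #|G|) = 2 ->
  exists (p q : nat) (P Q : {group gT}),
    [/\ p != q, p.-group P /\ P :!=: 1, q.-group Q /\ Q :!=: 1 & P \x Q = G].
Proof.
move=> cGG; have := primes_uniq #|G|.
case def_primes: (primes _) => [|p [|q []]] //=; rewrite inE andbT => neq_pq _.
have [Gp Gq] : p \in primes #|G| /\ q \in primes #|G|.
  by rewrite def_primes !inE !eqxx orbT.
exists p, q, 'O_p(G)%G, 'O_p^'(G)%G; split=> //.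
- by rewrite pcore_pgroup (pcore_neq1 _ Gp) ?inE.
- rewrite (pcore_neq1 _ Gq) ?inE ?(eq_sym q) //; split=> //.
  apply: sub_in_pnat (pcore_pgroup _ _) => r r_pi.
  have: r \in primes #|G| by apply: piSg r_pi; apply: pcore_sub.
  by rewrite def_primes !inE => /orP[]/eqP-> //; rewrite eqxx.
exact: nilpotent_pcoreC (abelian_nil cGG).
Qed.

Lemma exists_max_degree_difference_graph (gT : finGroupType) (G : {group gT}) :
    abelian G -> size (primes #|G|) = 2 ->
  exists u, max_degree (difference_graph G) u.
Proof.
move=> cGG /(two_primes_dprod cGG)[p [q [P [Q]]]].
move=> [neq_pq [pP ntP] [qQ ntQ] defG].
exact: exists_max_degree_dprod pP qQ neq_pq defG ntP ntQ.
Qed.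

Lemma difference_graph_dprod (gT : finGroupType) (G : {group gT}) u :
    abelian G -> size (primes #|G|) = 2 -> max_degree (difference_graph G) u ->
  exists P Q : {group gT}, [/\ abelian P, abelian Q, P \x Q = G & forall n,
    #|'Ldiv_n(P)| = (coaxis_count (difference_graph G) u n).+1 /\
    #|'Ldiv_n(Q)| = (axis_count (difference_graph G) u n).+1].
Proof.
move=> cGG /(two_primes_dprod cGG)[p [q [P [Q]]]].
move=> [neq_pq [pP ntP] [qQ ntQ] defG] max_u.
have [defG' neq_qp] : Q \x P = G /\ q != p by rewrite dprodC eq_sym.
have [cPP cQQ] : abelian P /\ abelian Q.
  by split; apply: abelianS cGG; rewrite -(dprodW defG) (mulG_subl, mulG_subr).
case/orP: (max_degree_dprod_pair pP qQ neq_pq defG max_u) => /eqP u1.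
  exists P, Q; split=> // n.
  exact: (card_Ldiv_difference_graph pP qQ neq_pq defG cGG ntP ntQ n max_u).
exists Q, P; split=> // n.
exact: (card_Ldiv_difference_graph qQ pP neq_qp defG' cGG ntQ ntP n max_u).
Qed.

Theorem theorem3p13 (gT kT : finGroupType) (G : {group gT}) (K : {group kT})
    (abG : abelian G) (abK : abelian K)
    (piG : size (primes #|G|) = 2) (piK : size (primes #|K|) = 2)
    (isoD : graph_iso (difference_graph G) (difference_graph K)) :
  G \isog K.
Proof.
have [F F_bij F_mono] := isoD; have FE := core_embedding_bij F_bij F_mono.
have [u max_u] := exists_max_degree_difference_graph abG piG.
have nu := non_isolated_delete_isolated u.
have [P [Q [cPP cQQ defG LdivG]]] := difference_graph_dprod abG piG max_u.
have [P' [Q' [cPP' cQQ' defK LdivK]]] :=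
  difference_graph_dprod abK piK (core_max_degree FE max_u).
apply: (isog_dprod defG defK); apply: isog_abelian_card_Ldiv => // n.
  by rewrite (LdivG n).1 (LdivK n).1 (core_coaxis_count FE nu).
by rewrite (LdivG n).2 (LdivK n).2 (core_axis_count FE nu).
Qed.
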